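(* Let $P$ be a poset all of whose principal order ideals are finite and let $\phi:\phi(0)<\phi(1)<\cdots<\phi(n-1)$ be a finite nonempty chain in $P$. Then the lattice $\mathrm{Tam}(P,\phi)$ is join-extremal.
   Context: For $x\in P$, $I_P(x)=\{y\in P\mid y\le x\}$. For $0\le i<n$ let $\mathcal{C}_i=I_P(\phi(i))\times\{i\}$, ordered by $(x,i)\le (y,i)$ iff $x\le y$ in $P$, and let $\mathcal{C}_P^{\phi}=\bigsqcup_{0\le i<n}\mathcal{C}_i$ be the disjoint union of these posets (elements of different components are incomparable). An order filter (up-closed subset) $T$ of $\mathcal{C}_P^{\phi}$ is torclosed if for all $0\le i<j<n$ and all $x$, $(x,i)\in T$ and $(\phi(i+1),j)\in T$ imply $(x,j)\in T$. $\mathrm{Tam}(P,\phi)$ is the set of torclosed subsets of $\mathcal{C}_P^{\phi}$ ordered by inclusion; it is a finite lattice whose meet is intersection. A join-irreducible of a finite lattice is an element covering exactly one element; $\mathrm{JIrr}(L)$ is the set of join-irreducibles of $L$. The length of a chain $x_0<x_1<\cdots<x_k$ is $k$, and $\ell(L)$ is the maximum length of a chain in $L$. A finite lattice $L$ is join-extremal if $\ell(L)=|\mathrm{JIrr}(L)|$. *)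

(* Defs.v *)
From HB Require Import structures.
From mathcomp Require Import all_boot all_order finmap.
From mathcomp Require Import boolp classical_sets functions cardinality.

Set Implicit Arguments.
Unset Strict Implicit.
Unset Printing Implicit Defensive.

Import Order.Theory.

Local Open Scope classical_set_scope.
Local Open Scope order_scope.

Section JoinExtremal.
Context {d : Order.disp_t}.
Implicit Types L : finLatticeType d.

Definition covers L (x y : L) : bool :=
  (y < x) && [forall z : L, ~~ ((y < z) && (z < x))].

Definition JIrr L : {set L} :=
  [set x : L | #|[set y : L | covers x y]%SET| == 1%N]%SET.

(* A chain x_0 < ... < x_k is a strictly sorted (k+1)-tuple; k < #|L| always
   holds since its entries are distinct, see [lattice_length_max]. *)
Definition lattice_length L : nat :=
  \max_(k < #|L| | [exists t : k.+1.-tuple L, sorted <%O t]) k.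

Definition join_extremal L : Prop := lattice_length L = #|JIrr L|.

Lemma lattice_length_max L (x : L) (s : seq L) :
  path <%O x s -> (size s <= lattice_length L)%N.
Proof.
move=> xs; have ltk : (size s < #|L|)%N.
  have us : uniq (x :: s) by apply: (sorted_uniq lt_trans ltxx).
  by have := max_card [in x :: s]; rewrite (card_uniqP us).
apply: (@leq_bigmax_cond _ _ (@nat_of_ord #|L|) (Ordinal ltk)).
by apply/existsP; exists (in_tuple (x :: s)).
Qed.

Lemma lattice_length_attained L (x0 : L) :
  exists (x : L) (s : seq L), path <%O x s /\ size s = lattice_length L.
Proof.
have L0 : (0 < #|L|)%N by apply/card_gt0P; exists x0.
pose Q (k : 'I_#|L|) := [exists t : k.+1.-tuple L, sorted <%O t].
have Q0 : (0 < #|Q|)%N.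
  by apply/card_gt0P; exists (Ordinal L0); apply/existsP; exists [tuple x0].
have [k Qk maxk] := eq_bigmax_cond (@nat_of_ord #|L|) Q0.
have -> : lattice_length L = k by rewrite -maxk; apply: eq_bigl.
have /existsP[[[//|x s] /= sz] st] := Qk.
by exists x, s; split=> //; move/eqP: sz => [].
Qed.

End JoinExtremal.

Section Tamari.
Context {d : Order.disp_t} {P : porderType d} {n : nat}.
Implicit Types (phi : 'I_n -> P) (T U X : set (P * 'I_n)).

Definition principal_ideal (x : P) : set P := [set y | y <= x].

Definition ideal_sum phi : set (P * 'I_n) :=
  \bigcup_(i in [set: 'I_n]) (principal_ideal (phi i) `*` [set i]).

Definition ideal_sum_le (a b : P * 'I_n) : bool :=
  (a.1 <= b.1) && (a.2 == b.2).

Definition order_filter phi T : Prop :=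
  T `<=` ideal_sum phi /\
  forall a b, T a -> ideal_sum phi b -> ideal_sum_le a b -> T b.

(* [i1] stands for i + 1, which is smaller than n because i < j. *)
Definition torclosed phi T : Prop :=
  order_filter phi T /\
  forall (i i1 j : 'I_n) (x : P), (i < j)%N -> i1 = i.+1 :> nat ->
    T (x, i) -> T (phi i1, j) -> T (x, j).

Lemma ideal_sumE phi x i : ideal_sum phi (x, i) <-> x <= phi i.
Proof. by split=> [[j _ [/= h ->]]|h] //; exists i. Qed.

Lemma ideal_sum_le_refl : reflexive ideal_sum_le.
Proof. by move=> a; rewrite /ideal_sum_le lexx eqxx. Qed.

Lemma ideal_sum_le_anti : antisymmetric ideal_sum_le.
Proof.
move=> [x i] [y j] /= /andP[/andP[/= xy /eqP ->] /andP[/= yx _]].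
by congr pair; apply/le_anti/andP.
Qed.

Lemma ideal_sum_le_trans : transitive ideal_sum_le.
Proof.
move=> b a c /andP[ab /eqP ij] /andP[bc /eqP jk].
by rewrite /ideal_sum_le (le_trans ab bc) ij jk eqxx.
Qed.

Lemma finite_ideal_sum phi :
  (forall x : P, finite_set (principal_ideal x)) ->
  finite_set (ideal_sum phi).
Proof.
move=> hP; apply: bigcup_finite => [|i _]; first exact: finite_finset.
by apply: finite_setX.
Qed.

Lemma finite_torclosed phi :
  (forall x : P, finite_set (principal_ideal x)) ->
  finite_set [set T | torclosed phi T].
Proof.
move=> /(finite_ideal_sum phi) /finite_fsetP[C defC].
pose F (X : {fset P * 'I_n}) : set (P * 'I_n) := [set` X].
apply: (@sub_finite_set _ _ (F @` [set` fpowerset C])); last first.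
  exact/finite_image/finite_fset.
move=> T [[TC _] _]; have finT : finite_set T.
  by apply: sub_finite_set TC _; rewrite defC; exact: finite_fset.
exists (fset_set T); last by rewrite /F fset_setK.
rewrite /= fpowersetE; apply/fsubsetP => a; rewrite in_fset_set // inE => /TC.
by rewrite defC.
Qed.

Lemma torclosedI phi T U :
  torclosed phi T -> torclosed phi U -> torclosed phi (T `&` U).
Proof.
move=> [[TC fT] tT] [[UC fU] tU]; split.
  split=> [a [/TC]//|a b [Ta Ua] Cb ab].
  by split; [exact: fT Ta Cb ab|exact: fU Ua Cb ab].
move=> i i1 j x ij ii1 [T1 U1] [T2 U2].
by split; [exact: tT ij ii1 T1 T2|exact: tU ij ii1 U1 U2].
Qed.

Lemma torclosed0 phi : torclosed phi set0.
Proof. by split=> //; split. Qed.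

Lemma torclosed_ideal_sum phi :
  (forall i j : 'I_n, (i < j)%N -> phi i < phi j) ->
  torclosed phi (ideal_sum phi).
Proof.
move=> hphi; split=> [|i i1 j x ij _ /ideal_sumE xi _]; first by split.
by apply/ideal_sumE/(le_trans xi)/ltW/hphi.
Qed.

(* The smallest torclosed set containing X, when X lies in ideal_sum phi. *)
Definition tor_closure phi X : set (P * 'I_n) :=
  ideal_sum phi `&` \bigcap_(T in [set T | torclosed phi T /\ X `<=` T]) T.

Lemma tor_closureP phi X :
  (forall i j : 'I_n, (i < j)%N -> phi i < phi j) ->
  torclosed phi (tor_closure phi X).
Proof.
move=> hphi; split.
  split=> [a []//|a b [Ca Ta] Cb ab]; split=> // T hT.
  by case: (hT) => -[[_ fT] _] _; apply: fT (Ta _ hT) Cb ab.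
move=> i i1 j x ij ii1 [C1 T1] [C2 T2]; split.
  by have [_ tC] := torclosed_ideal_sum hphi; apply: tC ij ii1 C1 C2.
by move=> T hT; case: (hT) => -[_ tT] _; apply: tT ij ii1 (T1 _ hT) (T2 _ hT).
Qed.

Lemma tor_closure_sub phi X T :
  (forall i j : 'I_n, (i < j)%N -> phi i < phi j) ->
  X `<=` ideal_sum phi -> torclosed phi T ->
  (tor_closure phi X `<=` T) <-> (X `<=` T).
Proof.
move=> hphi XC tT; split=> [XT a Xa|XT a [_]]; last exact.
by apply: XT; split=> [|U [_]]; [exact: XC|apply].
Qed.

(* The two hypotheses are unused in the body: the first one makes [fset_set]
   meaningful (it is empty on infinite sets), and the second one is needed for
   the lattice structure below, whose top element is [ideal_sum phi].
   The order is inclusion, inherited from the library order on sets. *)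
Definition Tam phi
    (hP : forall x : P, finite_set (principal_ideal x))
    (hphi : forall i j : 'I_n, (i < j)%N -> phi i < phi j) : Type :=
  fset_set [set T | torclosed phi T].

End Tamari.

Section TamariLattice.
Context {d : Order.disp_t} {P : porderType d} {n : nat} {phi : 'I_n -> P}.
Context (hP : forall x : P, finite_set (principal_ideal x)).
Context (hphi : forall i j : 'I_n, (i < j)%N -> phi i < phi j).

Local Notation Tam := (Tam hP hphi).

HB.instance Definition _ := Finite.on Tam.
HB.instance Definition _ := SubChoice.on Tam.
HB.instance Definition _ := [SubChoice_isSubPOrder of Tam by <: with set_display].

Lemma TamP (A : Tam) : torclosed phi (val A).
Proof.
by have := valP A; rewrite in_fset_set ?inE //; exact: finite_torclosed.
Qed.

Lemma tor_in (T : set (P * 'I_n)) :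
  torclosed phi T -> T \in fset_set [set T | torclosed phi T].
Proof. by move=> tT; rewrite in_fset_set ?inE //; exact: finite_torclosed. Qed.

Definition mkTam T (tT : torclosed phi T) : Tam := FSetSub (tor_in tT).

Lemma leTamE (A B : Tam) : (A <= B) = `[< val A `<=` val B >].
Proof. by rewrite -subsetEset asboolb. Qed.

Definition tam_meet (A B : Tam) : Tam := mkTam (torclosedI (TamP A) (TamP B)).

Definition tam_join (A B : Tam) : Tam :=
  mkTam (tor_closureP (val A `|` val B) hphi).

Lemma tam_meetP (A B C : Tam) : (A <= tam_meet B C) = (A <= B) && (A <= C).
Proof.
rewrite !leTamE -asbool_and; apply: asbool_equiv_eq => /=.
by rewrite subsetI.
Qed.

Lemma tam_joinP (A B C : Tam) : (tam_join A B <= C) = (A <= C) && (B <= C).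
Proof.
rewrite !leTamE -asbool_and; apply: asbool_equiv_eq => /=.
rewrite tor_closure_sub //; [by rewrite subUset| |exact: TamP].
by rewrite subUset; split; [case: (TamP A) => -[]|case: (TamP B) => -[]].
Qed.

HB.instance Definition _ :=
  Order.POrder_MeetJoin_isLattice.Build _ Tam tam_meetP tam_joinP.

Lemma tam_le0x (A : Tam) : mkTam (torclosed0 phi) <= A.
Proof. by rewrite leTamE; apply/asboolP. Qed.

Lemma tam_lex1 (A : Tam) : A <= mkTam (torclosed_ideal_sum hphi).
Proof. by rewrite leTamE; apply/asboolP; case: (TamP A) => -[]. Qed.

HB.instance Definition _ := Order.hasBottom.Build _ Tam tam_le0x.
HB.instance Definition _ := Order.hasTop.Build _ Tam tam_lex1.

Lemma val_meet_tam (A B : Tam) : val (A `&` B) = (val A `&` val B)%classic.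
Proof. by []. Qed.

End TamariLattice.

(* Main.v *)
Require Import Defs.
From mathcomp Require Import all_boot all_order finmap.
From mathcomp Require Import boolp classical_sets functions cardinality.

Import Order.Theory.

Local Open Scope order_scope.

(* A set lying in a single component of C is torclosed as soon as it is an order
   filter.  Hence the smallest torclosed set containing an element a is the
   principal filter of a, it becomes torclosed again when a is removed, and the
   join-irreducibles are exactly the principal filters: |JIrr| = |C|, where C = C_P^phi.
   A chain of torclosed sets has length at most |C|, and this is attained by
   filling the components one by one in decreasing order of index, each along a
   linear extension: completeness of the components above makes every
   intermediate order filter torclosed. *)

(** * Covers, join-irreducibles and minimal elements in finite orders *)

Section FiniteOrders.

(** Among the elements at least [y] and strictly below [x], one with the largest down-set is
    maximal, hence covered by [x]. *)
Lemma covers_exists (d : Order.disp_t) (L : finLatticeType d) (x y : L) :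
  y < x -> exists2 z, covers x z & y <= z.
Proof.
move=> yx; pose Q z := (y <= z) && (z < x).
have Qy : Q y by rewrite /Q lexx.
have [z /andP[yz zx] zmax] := arg_maxnP (fun z => #|[set w | w <= z]|%SET) Qy.
exists z => //; rewrite /covers zx; apply/forallP => w; apply/negP => /andP[zw wx].
have := zmax w; rewrite /Q wx (le_trans yz (ltW zw)) => /(_ isT) /=.
rewrite leqNgt => /negP; apply; apply/proper_card/properP; split.
  apply/fintype.subsetP => v; rewrite !inE => vz.
  exact: le_trans vz (ltW zw).
by exists w; rewrite !inE ?lexx // lt_geF.
Qed.

(** Every element strictly below [x] lies under a lower cover of [x], so a unique lower cover is the
    greatest element strictly below [x]. *)
Lemma JIrrP (d : Order.disp_t) (L : finLatticeType d) (x : L) :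
  x \in JIrr L <-> exists2 z, z < x & forall y, y < x -> y <= z.
Proof.
rewrite inE; split.
  move=> /cards1P[z defz].
  have : z \in [set y | covers x y]%SET by rewrite defz set11.
  rewrite inE => /andP[zx _]; exists z => // y /covers_exists[w xw yw].
  have : w \in [set y | covers x y]%SET by rewrite inE.
  by rewrite defz => /set1P <-.
move=> [z zx zmax]; apply/cards1P; exists z; apply/setP => w; rewrite !inE.
apply/idP/eqP => [/andP[/zmax wz /forallP/(_ z)]|->].
  rewrite zx andbT => zw; apply/eqP; move: wz zw.
  by rewrite le_eqVlt => /orP[|->].
rewrite /covers zx; apply/forallP => y; apply/negP => /andP[zy /zmax yz].
by rewrite (lt_geF zy) in yz.
Qed.

(** Take [a] with the fewest predecessors in [X]: by transitivity and irreflexivity a predecessor of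
    [a] would have strictly fewer. *)
Lemma fset_minimal (T : choiceType) (r : rel T) (X : {fset T}) :
  irreflexive r -> transitive r -> X != fset0 ->
  exists2 a, a \in X & forall b, b \in X -> ~~ r b a.
Proof.
move=> rI rT /fset0Pn[x0 X0].
have [a _ amin] :=
  @arg_minnP _ [` X0]%fset predT (fun a => #|[set b : X | r (val b) (val a)]|%SET) isT.
exists (val a) => [|b Xb]; first exact: valP.
apply/negP => ba; have := amin [` Xb]%fset isT; rewrite leqNgt => /negP; apply.
apply/proper_card/properP; split.
  by apply/fintype.subsetP => c; rewrite !inE => /rT; apply.
by exists [` Xb]%fset; rewrite inE //= rI.
Qed.

End FiniteOrders.

(** * Principal filters and filters with complete upper components *)

Section Tamari.
Context {d : Order.disp_t} {P : porderType d} {n : nat} {phi : 'I_n -> P}.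
Implicit Types (T : set (P * 'I_n)) (a b : P * 'I_n).

Local Open Scope classical_set_scope.

Definition principal_filter (a : P * 'I_n) : set (P * 'I_n) :=
  [set b | ideal_sum phi b /\ ideal_sum_le a b].

(** Governs the order of removal of elements. It is only partial inside a component: removing
    minimal elements one at a time produces the linear extension. *)
Definition component_lt (a b : P * 'I_n) : bool :=
  (a.2 < b.2)%N || (a.2 == b.2) && (a.1 < b.1).

(** The shape of the sets in the longest chain: every component after the lowest nonempty one is
    complete. *)
Definition full_above T : Prop :=
  order_filter phi T /\
  forall (i j : 'I_n) x y, (i < j)%N -> T (x, i) -> y <= phi j -> T (y, j).

Lemma component_lt_irr : irreflexive component_lt.
Proof. by move=> a; rewrite /component_lt ltnn ltxx andbF. Qed.

Lemma component_lt_trans : transitive component_lt.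
Proof.
move=> [y j] [x i] [z k]; rewrite /component_lt /=.
move=> /orP[ij|/andP[/eqP -> xy]] /orP[jk|/andP[/eqP <- yz]].
- by rewrite (ltn_trans ij jk).
- by rewrite ij.
- by rewrite jk.
- by rewrite eqxx (lt_trans xy yz) orbT.
Qed.

Lemma ideal_sum_le_component_lt a b :
  ideal_sum_le a b -> a <> b -> component_lt a b.
Proof.
case: a b => [x i] [y j] /andP[/= xy /eqP <-] ab.
rewrite /component_lt /= eqxx lt_neqAle xy !andbT.
by apply/orP; right; apply/eqP => exy; apply: ab; rewrite exy.
Qed.

(** The closure condition has premises in two distinct components, so it holds vacuously. *)
Lemma single_component_torclosed T :
  order_filter phi T -> (forall a b, T a -> T b -> a.2 = b.2) -> torclosed phi T.
Proof.
move=> fT T1; split=> // i i1 j x ij _ Ti Tj.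
by have /= eij := T1 _ _ Ti Tj; rewrite eij ltnn in ij.
Qed.

Lemma principal_filter_component a b : principal_filter a b -> b.2 = a.2.
Proof. by case=> _ /andP[_ /eqP]. Qed.

Lemma principal_filter_torclosed a : torclosed phi (principal_filter a).
Proof.
apply: single_component_torclosed; last first.
  by move=> b c /principal_filter_component -> /principal_filter_component ->.
split=> [b []//|b c [_ ab] Cc bc].
by split=> //; exact: ideal_sum_le_trans ab bc.
Qed.

Lemma principal_filterD1_torclosed a : torclosed phi (principal_filter a `\ a).
Proof.
apply: single_component_torclosed; last first.
  by move=> b c [/principal_filter_component -> _] [/principal_filter_component -> _].
split=> [b [[]]//|b c [[_ ab] nab] Cc bc].
split; first by split=> //; exact: ideal_sum_le_trans ab bc.
by move=> /= ca; apply: nab; apply: ideal_sum_le_anti; rewrite ab -ca bc.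
Qed.

Lemma principal_filter_sub T a :
  torclosed phi T -> T a -> principal_filter a `<=` T.
Proof. by move=> [[_ fT] _] Ta b [Cb ab]; exact: fT Ta Cb ab. Qed.

(** Minimality of [a] excludes smaller elements in its own component, so a filter remains, and any
    element in an earlier component, so the component of [a] may become incomplete. *)
Lemma full_aboveD1 T a :
  full_above T -> (forall b, T b -> ~~ component_lt b a) -> full_above (T `\ a).
Proof.
move=> [[TC fT] uT] amin; split; first split.
- by move=> b [/TC].
- move=> b c [Tb nb] Cc bc; split; first exact: fT Tb Cc bc.
  move=> /= ca; have /negP := amin _ Tb; apply.
  by apply: ideal_sum_le_component_lt => //; rewrite -ca.
- move=> i j x y ij [Ti _] yj; split; first exact: uT ij Ti yj.
  by move=> /= ea; have := amin _ Ti; rewrite -ea /component_lt ij.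
Qed.

(** * Chains of torclosed sets and the length of the lattice *)

Context (hP : forall x : P, finite_set (principal_ideal x)).
Context (hphi : forall i j : 'I_n, (i < j)%N -> phi i < phi j).
Local Notation Tam := (Tam hP hphi).
Implicit Types A B : Tam.

(** If [(x, i)] is in [T], then [x <= phi i <= phi j], so [(x, j)] lies in the complete component
    [j]. *)
Lemma full_above_torclosed T : full_above T -> torclosed phi T.
Proof.
move=> [[TC fT] uT]; split=> // i i1 j x ij _ Ti _.
apply: (uT _ _ _ _ ij Ti); apply: (le_trans _ (ltW (hphi _ _ ij))).
exact/ideal_sumE/TC.
Qed.

Lemma full_above_ideal_sum : full_above (ideal_sum phi).
Proof.
split; first by case: (torclosed_ideal_sum hphi).
by move=> i j x y _ _ yj; apply/ideal_sumE.
Qed.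

Lemma tam_sub A : val A `<=` ideal_sum phi.
Proof. by case: (TamP A) => -[]. Qed.

Lemma tam_finite A : finite_set (val A).
Proof. exact: sub_finite_set (tam_sub A) (finite_ideal_sum phi hP). Qed.

Lemma leTamP A B : reflect (val A `<=` val B) (A <= B).
Proof. by rewrite leTamE; exact: asboolP. Qed.

Lemma ltTam_card A B :
  A < B -> (#|` fset_set (val A)| < #|` fset_set (val B)|)%N.
Proof.
move=> AB; apply: fproper_ltn_card; rewrite fproperEneq; apply/andP; split.
  apply/eqP => /(fset_set_inj (tam_finite A) (tam_finite B)) /val_inj eAB.
  by rewrite eAB ltxx in AB.
by rewrite -fset_set_sub; [exact/leTamP/ltW|exact: tam_finite|exact: tam_finite].
Qed.

(** Each step of a chain adds at least one element to the set. *)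
Lemma path_tam_card A (s : seq Tam) : path <%O A s ->
  (size s + #|` fset_set (val A)| <= #|` fset_set (val (last A s))|)%N.
Proof.
elim: s A => [//|B s IHs] A /= /andP[AB /IHs]; apply: leq_trans.
by rewrite addSnnS leq_add2l ltTam_card.
Qed.

(** The chain is built downwards from [B]: removing a [component_lt]-minimal element preserves
    [full_above] and lowers the cardinality by exactly one. *)
Lemma full_above_chain m B :
  full_above (val B) -> #|` fset_set (val B)| = m ->
  exists A (s : seq Tam), [/\ path <%O A s, size s = m & last A s = B].
Proof.
elim: m B => [|m IHm] B fB cB; first by exists B, [::].
have B0 : fset_set (val B) != fset0 by rewrite -cardfs_gt0 cB.
have [a] := fset_minimal _ _ _ component_lt_irr component_lt_trans B0.
have finB := tam_finite B.
rewrite in_fset_set // inE => Ba amin.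
have fD : full_above (val B `\ a).
  by apply: full_aboveD1 fB _ => b Bb; apply: amin; rewrite in_fset_set // inE.
pose D : Tam := mkTam hP hphi (full_above_torclosed _ fD).
have cD : #|` fset_set (val D)| = m.
  move: cB; rewrite (cardfsD1 a) in_fset_set // mem_set // => -[<-].
  by rewrite -fset_setD1.
have [A [s [As ss ls]]] := IHm D fD cD.
exists A, (rcons s B); rewrite rcons_path As size_rcons ss last_rcons ls.
split=> //=; rewrite lt_neqAle; apply/andP; split; last first.
  by apply/leTamP => b [].
by apply/eqP => eD; move: Ba; rewrite -eD => -[_]; apply.
Qed.

Lemma lattice_length_Tam :
  lattice_length Tam = #|` fset_set (ideal_sum phi)|.
Proof.
pose C : Tam := mkTam hP hphi (torclosed_ideal_sum hphi).
apply/eqP; rewrite eqn_leq; apply/andP; split.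
  have [A [s [As <-]]] := lattice_length_attained C.
  have := path_tam_card _ _ As; move/(leq_trans (leq_addr _ _))/leq_trans; apply.
  apply: fsubset_leq_card; rewrite -fset_set_sub; [exact: tam_sub|exact: tam_finite|].
  exact: finite_ideal_sum.
(* Lower bound: the chain descending from the top element [C]. *)
have [A [s [As <- _]]] := full_above_chain _ C full_above_ideal_sum erefl.
exact: lattice_length_max As.
Qed.

(** * Join-irreducibles as principal filters *)

Definition tam_principal (a : fset_set (ideal_sum phi)) : Tam :=
  mkTam hP hphi (principal_filter_torclosed (val a)).

Lemma mem_principal_filter (a : fset_set (ideal_sum phi)) :
  principal_filter (val a) (val a).
Proof.
split; last exact: ideal_sum_le_refl.
by have := valP a; rewrite in_fset_set ?inE //; exact: finite_ideal_sum.
Qed.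

Lemma tam_principal_inj : injective tam_principal.
Proof.
move=> a b eab; apply/val_inj/ideal_sum_le_anti/andP; split.
  have : val (tam_principal a) (val b) by rewrite eab; exact: mem_principal_filter.
  by case.
have : val (tam_principal b) (val a) by rewrite -eab; exact: mem_principal_filter.
by case.
Qed.

Lemma JIrr_Tam : JIrr Tam = (tam_principal @: [set: fset_set (ideal_sum phi)])%SET.
Proof.
apply/setP => A; apply/idP/imsetP => [/JIrrP[B BA Bmax]|[a _ ->]].
  (* If [A] is not principal, the filter of each of its elements is strictly below [A], hence below
     [B]; this forces [A <= B]. *)
  apply: contrapT => nA.
  suff : A <= B by move=> /(lt_le_trans BA); rewrite ltxx.
  apply/leTamP => a Aa.
  have Ca : a \in fset_set (ideal_sum phi).
    by rewrite in_fset_set ?inE; [exact: tam_sub Aa|exact: finite_ideal_sum].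
  pose a' : fset_set (ideal_sum phi) := [` Ca]%fset.
  have /leTamP : tam_principal a' <= B.
    apply: Bmax; rewrite lt_neqAle; apply/andP; split.
      by apply/eqP => eA; apply: nA; exists a'.
    by apply/leTamP; exact: principal_filter_sub (TamP A) Aa.
  by apply; exact: mem_principal_filter a'.
(* The greatest element strictly below a principal filter is that filter without its generator. *)
apply/JIrrP; exists (mkTam hP hphi (principal_filterD1_torclosed (val a))).
  rewrite lt_neqAle; apply/andP; split; last by apply/leTamP => b [].
  apply/eqP => e; have := mem_principal_filter a.
  by rewrite -[principal_filter _]/(val (tam_principal a)) -e => -[_]; apply.
move=> B; rewrite lt_neqAle => /andP[/eqP nB /leTamP BJ].
apply/leTamP => b Bb; split; first exact: BJ.
(* A torclosed set containing the generator contains the whole filter, so [B] would equal it. *)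
move=> /= eb; apply: nB; apply/le_anti/andP; split; first exact/leTamP.
by rewrite eb in Bb; apply/leTamP; exact: principal_filter_sub (TamP B) Bb.
Qed.

End Tamari.

Theorem corollary3p16 (d : Order.disp_t) (P : porderType d)
    (hP : forall x : P, finite_set (principal_ideal x))
    (n : nat) (hn : (0 < n)%N) (phi : 'I_n -> P)
    (hphi : forall i j : 'I_n, (i < j)%N -> phi i < phi j) :
  join_extremal (Tam hP hphi).
Proof.
rewrite /join_extremal lattice_length_Tam JIrr_Tam card_imset ?cardsT ?cardfE //.
exact: tam_principal_inj.
Qed.
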